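(* Let $C$ be a compact (not necessarily convex) subset of $\mathbb{R}^n$. Let $f:C\to\mathbb{R}$ be an arbitrary function, and let $G:C\to\mathbb{R}^n$ be a continuous mapping. Then there exists a convex function $F\in C^1(\mathbb{R}^n)$ with $F=f$ on $C$ and $\nabla F=G$ on $C$ if and only if both of the following conditions hold: (a) $f(x)-f(y)\geq\langle G(y),x-y\rangle$ for all $x,y\in C$; (b) for all $x,y\in C$: if $f(x)-f(y)=\langle G(y),x-y\rangle$, then $G(x)=G(y)$. *)

(* Defs.v *)
From mathcomp Require Import all_boot all_order all_algebra.
From mathcomp Require Import all_classical all_reals all_analysis.

Set Implicit Arguments.
Unset Strict Implicit.
Unset Printing Implicit Defensive.

Import Order.TTheory GRing.Theory Num.Theory.
Import numFieldNormedType.Exports.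

Local Open Scope classical_set_scope.
Local Open Scope ring_scope.

(* Euclidean space R^n is 'rV[R]_n.  The library norm there is the sup norm,
   which induces the same topology and the same notion of differentiability as
   the Euclidean one. *)

Definition dotv (R : realType) (n : nat) (u v : 'rV[R]_n) : R :=
  \sum_(i < n) u 0 i * v 0 i.

Definition gradient (R : realType) (n : nat) (F : 'rV[R]_n -> R)
    (x : 'rV[R]_n) : 'rV[R]_n :=
  \row_(i < n) 'D_(delta_mx 0 i) F x.

(* 'D is total (a junk value where the limit does not exist), so
   differentiability is required separately. *)
Definition C1_function (R : realType) (n : nat) (F : 'rV[R]_n -> R) : Prop :=
  (forall x, differentiable F x) /\ continuous (gradient F).

(* Main.v *)
Require Import Defs.
From HB Require Import structures.
From mathcomp Require Import all_boot all_order all_algebra.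
From mathcomp Require Import all_classical all_reals all_analysis.
From mathcomp Require Import ring lra.

(* For the converse, F is built as a conjugate function.  By compactness and
   (b), the excess D(x,y) = f(x) - f(y) - <G(y), x - y> dominates
   h(|G(x) - G(y)|^2) for some convex increasing h with h(0) = 0 and h > 0 on
   the positive reals.  Then
     H(p) = max_{x in C} (<x,p> - f(x) + h(|p - G(x)|^2))
   is strictly convex and continuous, H(G(x)) = <x, G(x)> - f(x), and x is a
   subgradient of H at G(x).  Hence, on a compact convex set B containing G(C),
   p |-> <z,p> - H(p) has a unique maximizer g(z), which depends continuously
   on z and equals G(z) when z is in C; the maximal value F(z) is convex with
   gradient g and equals f on C. *)

Set Implicit Arguments.
Unset Strict Implicit.
Unset Printing Implicit Defensive.

Import Order.TTheory GRing.Theory Num.Theory.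
Import numFieldNormedType.Exports.

Local Open Scope classical_set_scope.
Local Open Scope ring_scope.

(** * Euclidean inner product: algebra, bounds, continuity *)

Lemma dotvC (R : realType) (n : nat) (u v : 'rV[R]_n) : dotv u v = dotv v u.
Proof. by apply: eq_bigr => i _; rewrite mulrC. Qed.

Lemma dotvDr (R : realType) (n : nat) (u v w : 'rV[R]_n) :
  dotv u (v + w) = dotv u v + dotv u w.
Proof.
by rewrite /dotv -big_split; apply: eq_bigr => i _; rewrite mxE mulrDr.
Qed.

Lemma dotvZr (R : realType) (n : nat) (u v : 'rV[R]_n) (a : R) :
  dotv u (a *: v) = a * dotv u v.
Proof.
by rewrite /dotv mulr_sumr; apply: eq_bigr => i _; rewrite mxE mulrCA.
Qed.

Lemma dotvNr (R : realType) (n : nat) (u v : 'rV[R]_n) :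
  dotv u (- v) = - dotv u v.
Proof. by rewrite -scaleN1r dotvZr mulN1r. Qed.

Lemma dotvBr (R : realType) (n : nat) (u v w : 'rV[R]_n) :
  dotv u (v - w) = dotv u v - dotv u w.
Proof. by rewrite dotvDr dotvNr. Qed.

Lemma dotvDl (R : realType) (n : nat) (u v w : 'rV[R]_n) :
  dotv (v + w) u = dotv v u + dotv w u.
Proof. by rewrite dotvC dotvDr !(dotvC u). Qed.

Lemma dotvZl (R : realType) (n : nat) (u v : 'rV[R]_n) (a : R) :
  dotv (a *: v) u = a * dotv v u.
Proof. by rewrite dotvC dotvZr dotvC. Qed.

Lemma dotvBl (R : realType) (n : nat) (u v w : 'rV[R]_n) :
  dotv (v - w) u = dotv v u - dotv w u.
Proof. by rewrite dotvC dotvBr !(dotvC u). Qed.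

Lemma dotvNl (R : realType) (n : nat) (u v : 'rV[R]_n) :
  dotv (- v) u = - dotv v u.
Proof. by rewrite dotvC dotvNr dotvC. Qed.

Definition dotvE := (dotvDr, dotvNr, dotvZr, dotvDl, dotvNl, dotvZl).

Lemma dotv0r (R : realType) (n : nat) (u : 'rV[R]_n) : dotv u 0 = 0.
Proof. by rewrite -(subrr u) dotvBr subrr. Qed.

Lemma dotvv_ge0 (R : realType) (n : nat) (u : 'rV[R]_n) : 0 <= dotv u u.
Proof. by apply: sumr_ge0 => i _; rewrite -expr2 sqr_ge0. Qed.

Lemma dotvv_eq0 (R : realType) (n : nat) (u : 'rV[R]_n) :
  (dotv u u == 0) = (u == 0).
Proof.
apply/eqP/eqP => [u0|->]; last first.
  exact: dotv0r.
apply/rowP => i; rewrite mxE; apply/eqP; rewrite -sqrf_eq0 expr2.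
have /psumr_eq0P -> // : forall j, true -> 0 <= u 0 j * u 0 j.
by move=> j _; rewrite -expr2 sqr_ge0.
Qed.

Lemma coord_ler_norm (R : realType) (n : nat) (u : 'rV[R]_n) (i : 'I_n) :
  `|u 0 i| <= `|u|.
Proof.
rewrite [X in _ <= X]/Num.Def.normr/= mx_normrE.
exact: (le_bigmax _ (fun ij : 'I_1 * 'I_n => `|u ij.1 ij.2|) (0, i)).
Qed.

(** The norm here is the sup norm, so the factor [n] takes the place of the constant 1 of
    Cauchy-Schwarz. *)
Lemma dotv_norm_le (R : realType) (n : nat) (u v : 'rV[R]_n) :
  `|dotv u v| <= n%:R * `|u| * `|v|.
Proof.
apply: (le_trans (ler_norm_sum _ _ _)).
rewrite -mulrA mulr_natl -[X in _ *+ X](card_ord n) -sumr_const ler_sum// => i _.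
by rewrite normrM ler_pM// coord_ler_norm.
Qed.

Lemma cvg_dotv (R : realType) (n : nat) (T : Type) (F : set_system T)
    {FF : Filter F} (u v : T -> 'rV[R]_n) (a b : 'rV[R]_n) :
  u @ F --> a -> v @ F --> b -> dotv (u x) (v x) @[x --> F] --> dotv a b.
Proof.
move=> ua vb; rewrite /dotv; apply: cvg_big => [|i _].
  by move=> z; exact: add_continuous.
have coord (w : T -> 'rV[R]_n) (c : 'rV[R]_n) :
    w @ F --> c -> w x 0 i @[x --> F] --> c 0 i.
  apply: (@continuous_cvg _ _ _ _ _ w (fun M : 'rV[R]_n => M 0 i)).
  exact: coord_continuous.
exact: (cvgM (coord _ _ ua) (coord _ _ vb)).
Qed.

(** * Gradients of convex functions: necessity of (a) and (b) *)

(** The library bundles the weight as an element of [{i01 R}]; this form takes a plain real. *)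
Lemma convex_functionP (R : realType) (n : nat) (F : 'rV[R]_n -> R) :
  convex_function [set: 'rV[R]_n] F <->
  forall (t : R) (x y : 'rV[R]_n), 0 <= t <= 1 ->
    F (t *: x + (1 - t) *: y) <= t * F x + (1 - t) * F y.
Proof.
split=> [cF t x y t01|cF t x y _ _]; last by apply: cF; rewrite ge0 le1.
have H : Itv.spec (@Itv.num_sem R) (Itv.Real `[0%Z, 1%Z]) t.
  by rewrite /Itv.spec/= /Itv.num_sem/= num_real/= in_itv/=.
pose t' : {i01 R} := Itv.mk H.
by have := cF t' x y (in_setT _) (in_setT _).
Qed.

Lemma derive_dotv (R : realType) (n : nat) (F : 'rV[R]_n -> R) (a v : 'rV[R]_n) :
  differentiable F a -> 'D_v F a = dotv (gradient F a) v.
Proof.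
move=> dF; rewrite deriveE// [in LHS](row_sum_delta v) linear_sum.
by apply: eq_bigr => i _; rewrite linearZ mxE deriveE//= mulrC.
Qed.

Lemma cvg_gradient (R : realType) (n : nat) (F : 'rV[R]_n -> R) (a v : 'rV[R]_n) :
  differentiable F a ->
  t^-1 * (F (a + t *: v) - F a) @[t --> 0^'+] --> dotv (gradient F a) v.
Proof.
move=> dF; rewrite -derive_dotv//; apply: cvg_dnbhs_at_right.
have -> : (fun t => t^-1 * (F (a + t *: v) - F a)) =
  (fun t => t^-1 *: ((F \o shift a) (t *: v) - F a)).
  by apply/funext => t /=; rewrite [a + _]addrC.
exact: diff_derivable.
Qed.

Lemma gradient_le_slope (R : realType) (n : nat) (F : 'rV[R]_n -> R)
    (a v : 'rV[R]_n) (c : R) : differentiable F a ->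
  (forall t, 0 < t <= 1 -> F (a + t *: v) - F a <= t * c) ->
  dotv (gradient F a) v <= c.
Proof.
move=> /(@cvg_gradient _ _ _ _ v) dF h.
rewrite -(cvg_lim (@Rhausdorff _) dF); apply: limr_le; first exact: (cvgP _ dF).
near=> t; have t0 : 0 < t by [].
by rewrite mulrC ler_pdivrMr// mulrC h// t0/=; near: t; exact: nbhs_right_le.
Unshelve. all: by end_near. Qed.

Lemma gradient_ge_slope (R : realType) (n : nat) (F : 'rV[R]_n -> R)
    (a v : 'rV[R]_n) (c : R) : differentiable F a ->
  (forall t, 0 < t <= 1 -> t * c <= F (a + t *: v) - F a) ->
  c <= dotv (gradient F a) v.
Proof.
move=> /(@cvg_gradient _ _ _ _ v) dF h.
rewrite -(cvg_lim (@Rhausdorff _) dF); apply: limr_ge; first exact: (cvgP _ dF).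
near=> t; have t0 : 0 < t by [].
by rewrite mulrC ler_pdivlMr// mulrC h// t0/=; near: t; exact: nbhs_right_le.
Unshelve. all: by end_near. Qed.

Lemma convex_gradient_le (R : realType) (n : nat) (F : 'rV[R]_n -> R)
    (x y : 'rV[R]_n) : convex_function [set: 'rV[R]_n] F ->
  differentiable F y -> dotv (gradient F y) (x - y) <= F x - F y.
Proof.
move=> /convex_functionP cF dF; apply: gradient_le_slope => // t /andP[t0 t1].
have := cF t x y; rewrite ltW// t1 => /(_ isT).
have -> : t *: x + (1 - t) *: y = y + t *: (x - y).
  by rewrite scalerBl scale1r scalerBr addrCA.
by lra.
Qed.

(** By the equality, the tangent plane of [F] at [y] also touches the graph at [x]. It lies below
    [F], so the slope of [F] at [x] in any direction is at least that of the plane; the direction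
    [v] then gives [dotv v v <= 0]. *)
Lemma convex_gradient_eq (R : realType) (n : nat) (F : 'rV[R]_n -> R)
    (x y : 'rV[R]_n) : convex_function [set: 'rV[R]_n] F ->
  differentiable F x -> differentiable F y ->
  F x - F y = dotv (gradient F y) (x - y) -> gradient F x = gradient F y.
Proof.
move=> cF dx dy Fxy; set v := gradient F y - gradient F x.
have : dotv (gradient F y) v <= dotv (gradient F x) v.
  apply: gradient_ge_slope => // t _.
  have := convex_gradient_le (x + t *: v) cF dy.
  rewrite [x + _ - y]addrAC dotvDr dotvZr -Fxy; lra.
rewrite -subr_le0 -dotvBl -/v => v0; apply/esym/eqP.
by rewrite -subr_eq0 -dotvv_eq0 eq_le v0 dotvv_ge0.
Qed.

(** * Functions with a continuous choice of subgradient *)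

Lemma dotv_is_linear (R : realType) (n : nat) (u : 'rV[R]_n) :
  linear (dotv u : 'rV[R]_n -> R^o).
Proof. by move=> a v w; rewrite dotvDr dotvZr. Qed.

HB.instance Definition _ (R : realType) (n : nat) (u : 'rV[R]_n) :=
  GRing.isLinear.Build R 'rV[R]_n R^o *:%R (dotv u) (dotv_is_linear u).

Lemma dotv_continuous (R : realType) (n : nat) (u : 'rV[R]_n) :
  continuous (dotv u : 'rV[R]_n -> R).
Proof.
move=> v; exact: (@cvg_dotv _ _ _ (nbhs v) _ (fun=> u) id _ _ (cvg_cst u)).
Qed.

(** The subgradient inequalities at [z] and at [h + z] squeeze the first-order remainder between 0
    and [dotv (g (h + z) - g z) h], which is o(h) by continuity of [g]. *)
Lemma subgradient_diff (R : realType) (n : nat) (F : 'rV[R]_n -> R)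
    (g : 'rV[R]_n -> 'rV[R]_n) :
  (forall z w, dotv (g z) (w - z) <= F w - F z) -> continuous g ->
  forall z, differentiable F z /\ gradient F z = g z.
Proof.
move=> gF cg z.
have gz : g (h + z) @[h --> (0 : 'rV[R]_n)] --> g z.
  apply: (@continuous_cvg _ _ _ _ _ (shift z) g z); [exact: nbhs_filter|exact: cg|].
  rewrite -[X in _ --> X]add0r; exact: (cvgD cvg_id (cvg_cst z)).
move/cvgrPdist_le : gz => gz.
have Fo : F \o shift z = cst (F z) + dotv (g z) +o_ (0 : 'rV[R]_n) id.
  apply/eqaddoP => e e0; near=> h => /=.
  have := gF z (h + z); have := gF (h + z) z.
  rewrite addrK opprD addrCA subrr addr0 dotvNr => h1 h2.
  rewrite -[X in `|X|]/(F (h + z) - (F z + dotv (g z) h)) opprD addrA.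
  rewrite ger0_norm ?subr_ge0//.
  have : F (h + z) - F z - dotv (g z) h <= dotv (g (h + z) - g z) h.
    by rewrite dotvBl; lra.
  move=> /le_trans -> //; apply: (le_trans (ler_norm _)).
  apply: (le_trans (dotv_norm_le _ _)); apply: ler_wpM2r => //.
  (* [n.+1] instead of [n] keeps the divisor nonzero in dimension 0. *)
  apply: (@le_trans _ _ (n.+1%:R * (e / n.+1%:R))); last first.
    by rewrite mulrCA divff ?mulr1// pnatr_eq0.
  apply: ler_pM => //; first by rewrite ler_nat.
  by rewrite distrC; near: h; apply: gz; rewrite divr_gt0// ltr0n.
have dFE : 'd F z = dotv (g z) :> (_ -> _).
  by apply: diff_unique => //; exact: dotv_continuous.
have dF : differentiable F z.
  by apply/diff_locallyP; rewrite dFE; split=> //; exact: dotv_continuous.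
split=> //; apply/rowP => i; rewrite mxE deriveE// dFE.
rewrite /dotv (bigD1 i)//= big1 ?addr0 => [|j ji].
  by rewrite mxE !eqxx mulr1.
by rewrite mxE (negbTE ji) andbF mulr0.
Unshelve. all: by end_near. Qed.

(** The inequalities at [z = t x + (1 - t) y] towards [x] and [y], weighted by [t] and [1 - t], add
    up to convexity because their linear terms cancel. *)
Lemma subgradient_convex (R : realType) (n : nat) (F : 'rV[R]_n -> R)
    (g : 'rV[R]_n -> 'rV[R]_n) :
  (forall z w, dotv (g z) (w - z) <= F w - F z) ->
  convex_function [set: 'rV[R]_n] F.
Proof.
move=> gF; apply/convex_functionP => t x y /andP[t0 t1].
set z := t *: x + _.
have hx := ler_wpM2l t0 (gF z x).
have hy : (1 - t) * dotv (g z) (y - z) <= (1 - t) * (F y - F z).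
  by rewrite ler_wpM2l// subr_ge0.
suff : t * dotv (g z) (x - z) + (1 - t) * dotv (g z) (y - z) = 0 by lra.
by rewrite /z !dotvE; ring.
Qed.

(** * Convex moduli *)

Lemma convex_minorant (R : realType) (T : Type) (D q : T -> R) :
  (forall x, 0 <= D x) ->
  (forall e, 0 < e -> exists2 a, 0 < a & forall x, a * (q x - e) <= D x) ->
  exists h : R -> R,
    [/\ forall x, h (q x) <= D x,
        h 0 = 0,
        forall t, 0 < t -> 0 < h t,
        forall s t, s <= t -> 0 <= h t - h s <= t - s
      & forall l s t, 0 <= l <= 1 ->
          h (l * s + (1 - l) * t) <= l * h s + (1 - l) * h t].
Proof.
move=> D0 Dq.
(* h is the supremum of the affine functions [t |-> a t - b] with [(a, b)] in
   [S]; the bound [a <= 1] makes it finite and 1-Lipschitz *)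
pose S := [set p : R * R | [/\ 0 <= p.1, p.1 <= 1, 0 <= p.2 &
  forall x, p.1 * q x - p.2 <= D x]].
have S0 : S (0, 0) by split=> //= x; rewrite mul0r subr0.
pose V t := [set p.1 * t - p.2 | p in S].
pose h t := sup (V t).
have Vub t : has_sup (V t).
  split; first by exists (0 * t - 0), (0, 0).
  exists `|t| => _ [[a b] [/= a0 a1 b0 _] <-].
  have := ler_norm (a * t); rewrite normrM ger0_norm// => h1.
  by have := ler_wpM2r (normr_ge0 t) a1; rewrite mul1r; lra.
have hge t p : S p -> p.1 * t - p.2 <= h t.
  by move=> Sp; apply: ub_le_sup; [exact: (Vub t).2|exists p].
have hle t c : (forall p, S p -> p.1 * t - p.2 <= c) -> h t <= c.
  by move=> Hc; apply: ge_sup; [exact: (Vub t).1|move=> _ [p Sp <-]; exact: Hc].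
exists h; split.
- by move=> x; apply: hle => p [_ _ _]; exact.
- apply/eqP; rewrite eq_le; apply/andP; split.
    by apply: hle => p [_ _ p0 _]; rewrite mulr0 sub0r oppr_le0.
  by have := hge 0 _ S0; rewrite /= mulr0 subr0.
- move=> t t0; have [|a a0 aD] := Dq (t / 2); first lra.
  (* The line of slope [b] vanishing at [t / 2] is positive at [t]. It stays below [D]: beyond
     [t / 2] it is under the line of slope [a], before [t / 2] it is nonpositive. *)
  pose b := Num.min a 1.
  have b0 : 0 < b by rewrite lt_min a0 ltr01.
  have bt : 0 < b * (t / 2) by rewrite mulr_gt0//; lra.
  apply: (@lt_le_trans _ _ (b * t - b * (t / 2))).
    by rewrite -mulrBr mulr_gt0//; lra.
  apply: (hge t (b, b * (t / 2))); split=> /=; [exact: ltW| |exact: ltW|].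
    by rewrite ge_min lexx orbT.
  move=> x; rewrite -mulrBr; have [qt|qt] := leP 0 (q x - t / 2).
    by apply: le_trans (aD x); rewrite ler_wpM2r// ge_min lexx.
  by apply: le_trans (D0 x); rewrite mulr_ge0_le0// ltW.
- move=> s t st; apply/andP; split.
    rewrite subr_ge0; apply: hle => p Sp; apply: le_trans (hge t p Sp).
    by case: Sp => p0 _ _ _; rewrite lerD2r ler_wpM2l.
  rewrite lerBlDr; apply: hle => p Sp; have := hge s p Sp.
  case: Sp => p0 p1 _ _; have : p.1 * (t - s) <= 1 * (t - s).
    by rewrite ler_wpM2r// subr_ge0.
  by lra.
- move=> l s t /andP[l0 l1]; apply: hle => p Sp.
  have := ler_wpM2l l0 (hge s p Sp).
  have : (1 - l) * (p.1 * t - p.2) <= (1 - l) * h t.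
    by rewrite ler_wpM2l ?hge// subr_ge0.
  by lra.
Qed.

(** * Maxima over compact sets and strict convexity *)

(** By compactness, [phi (c, p)] is close to [phi (c, p0)] uniformly in [c], for [p] near [p0]; the
    two maxima are then equally close. *)
Lemma continuous_compact_max (R : realType) (T E : topologicalType) (K : set T)
    (phi : T * E -> R) : K !=set0 -> compact K -> continuous phi ->
  exists2 H : E -> R, continuous H &
    forall p, (exists2 c, K c & H p = phi (c, p)) /\
              (forall c, K c -> phi (c, p) <= H p).
Proof.
move=> K0 cK cphi.
have cphi1 p : continuous (fun c => phi (c, p)).
  move=> c; apply: (continuous_cvg _ (cphi (c, p))).
  exact: (cvg_pair cvg_id (cvg_cst p)).
have : forall p, exists c, K c /\ forall c', K c' -> phi (c', p) <= phi (c, p).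
  move=> p; have [c /set_mem Kc cmax] :=
    compact_EVT_max K0 cK (continuous_subspaceT (cphi1 p)).
  by exists c; split=> // c' Kc'; apply: cmax; rewrite inE.
move=> /choice[c cP]; exists (fun p => phi (c p, p)); last first.
  by move=> p; have [Kc cmax] := cP p; split=> //; exists (c p).
move=> p0; apply/cvgrPdist_le => e e0.
have near_phi : \forall p \near p0,
    K `<=` (fun x => `|phi (x, p) - phi (x, p0)| <= e).
  have /compact_near_coveringP := cK; apply => x Kx.
  have e20 : 0 < e / 2 by rewrite divr_gt0.
  have /cvgrPdist_le/(_ _ e20)[[A B] [/= nA nB] AB] := cphi (x, p0).
  have /cvgrPdist_le/(_ _ e20) nA' := cphi1 p0 x.
  exists (A `&` (fun c => `|phi (x, p0) - phi (c, p0)| <= e / 2), B) => /=.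
    by split=> //; exact: filterI.
  move=> [x' p] [/= [Ax' h2] Bp]; have := AB (x', p) (conj Ax' Bp).
  rewrite /= in h2 *; move: h2; rewrite !ler_norml => /andP[? ?] /andP[? ?].
  by apply/andP; split; lra.
near=> p.
have hp : K `<=` (fun x => `|phi (x, p) - phi (x, p0)| <= e) by near: p.
have [Kp pmax] := cP p; have [Kp0 p0max] := cP p0.
have := hp _ Kp; have := hp _ Kp0; have := pmax _ Kp0; have := p0max _ Kp.
rewrite !ler_norml => ? ? /andP[? ?] /andP[? ?]; apply/andP; split; lra.
Unshelve. all: by end_near. Qed.

(** Two distinct maximizers would be beaten by their midpoint. Continuity of [g] holds because the
    loss in the objective is bounded below away from [g z], while moving [z] slightly perturbs the
    objective by little on [B]. *)
Lemma strictly_convex_argmax (R : realType) (n : nat) (B : set 'rV[R]_n)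
    (H : 'rV[R]_n -> R) : B !=set0 -> compact B ->
  (forall p q, B p -> B q -> B (2^-1 *: (p + q))) ->
  continuous H ->
  (forall p q, p != q -> H (2^-1 *: (p + q)) < (H p + H q) / 2) ->
  exists2 g : 'rV[R]_n -> 'rV[R]_n, continuous g &
    forall z, B (g z) /\
      forall p, B p -> p != g z -> dotv z p - H p < dotv z (g z) - H (g z).
Proof.
move=> B0 cB Bmid cH Hmid.
have cdH z : continuous (fun p => dotv z p - H p).
  by move=> p; exact: (cvgB (@dotv_continuous _ _ z p) (cH p)).
have : forall z, exists p, B p /\
    forall q, B q -> dotv z q - H q <= dotv z p - H p.
  move=> z; have [p /set_mem Bp pmax] :=
    compact_EVT_max B0 cB (continuous_subspaceT (cdH z)).
  by exists p; split=> // q Bq; apply: pmax; rewrite inE.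
move=> /choice[g gP].
have gmax z p : B p -> p != g z -> dotv z p - H p < dotv z (g z) - H (g z).
  move=> Bp pg; have [Bg gzmax] := gP z.
  have := gzmax _ (Bmid _ _ Bp Bg); have := Hmid _ _ pg.
  by rewrite dotvZr dotvDr; lra.
exists g; last by move=> z; split; [exact: (gP z).1|exact: gmax].
move=> z; apply/(@cvgrPdist_le _ _ _ _ (nbhs_filter z)) => e e0.
pose gap p := dotv z (g z) - H (g z) - (dotv z p - H p).
(* On [B], [gap] vanishes only at [g z], where the other term equals [e]. So [Psi] has a positive
   minimum, which bounds [gap] from below at distance more than [e] from [g z]. *)
pose Psi := gap \max (fun p => e - `|g z - p|).
have cPsi : continuous Psi.
  move=> p; apply: (@continuous_max R _ gap).
    exact: (cvgB (cvg_cst _) (cdH z p)).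
  exact: (cvgB (cvg_cst _) (cvg_norm (cvgB (cvg_cst _) cvg_id))).
have [p0 /set_mem Bp0 p0min] := compact_EVT_min B0 cB (continuous_subspaceT cPsi).
have d0 : 0 < Psi p0.
  rewrite lt_max; have [->|pg] := eqVneq p0 (g z).
    by rewrite [X in _ || X]subr_gt0 subrr normr0 e0 orbT.
  by rewrite subr_gt0 gmax.
(* M w is the maximum over [p] in [B] of [dotv (z - w) (g z - p)], so that
   M w -> 0 as w -> z *)
have [|M cM MP] := @continuous_compact_max R _ _ B
  (fun pw : 'rV[R]_n * 'rV[R]_n => dotv (z - pw.2) (g z - pw.1)) B0 cB.
  by move=> [p w]; exact: (cvg_dotv (cvgB (cvg_cst _) cvg_snd)
    (cvgB (cvg_cst _) cvg_fst)).
have Mz : M z = 0.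
  by have [[c _ ->] _] := MP z; rewrite /= subrr dotvC dotv0r.
have := cM z; rewrite /continuous_at Mz => /cvgr_lt/(_ _ d0) nM.
near=> w; have [//|ew] := leP `|g z - g w| e.
(* Optimality of [g w] for [w] gives [gap (g w) <= dotv (z - w) (g z - g w) <= M w], below the
   minimum of [Psi]. *)
have [Bgw gwmax] := gP w.
have : Psi p0 <= Psi (g w) by apply: p0min; rewrite inE.
rewrite le_max => /orP[|]; last first.
  by move=> /(lt_le_trans d0); rewrite subr_gt0 => /(lt_trans ew); rewrite ltxx.
have : M w < Psi p0 by near: w.
have := gwmax _ (gP z).1; have := (MP w).2 _ Bgw.
by move: (Psi p0) => d; rewrite /gap/= !dotvE; lra.
Unshelve. all: by end_near. Qed.

(** The squared length [m] of the midpoint is strictly below the mean [s] of the squared lengths.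
    Since [m] is the combination of [s] and 0 with weight [m / s], convexity and [h 0 < h s] give
    [h m < h s]. *)
Lemma midpoint_comp_dotv (R : realType) (n : nat) (h : R -> R) :
  (forall t, 0 < t -> h 0 < h t) ->
  (forall l s t, 0 <= l <= 1 ->
    h (l * s + (1 - l) * t) <= l * h s + (1 - l) * h t) ->
  forall u v : 'rV[R]_n, u != v ->
  h (dotv (2^-1 *: (u + v)) (2^-1 *: (u + v))) <
    (h (dotv u u) + h (dotv v v)) / 2.
Proof.
move=> h0 hconv u v uv.
set m := dotv _ _; pose s := (dotv u u + dotv v v) / 2.
have ms : m < s.
  have : 0 < dotv (u - v) (u - v).
    by rewrite lt_def dotvv_ge0 dotvv_eq0 subr_eq0 uv.
  by rewrite /s /m !dotvE (dotvC v u); lra.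
have m0 : 0 <= m := dotvv_ge0 _.
have s0 : 0 < s by apply: le_lt_trans ms.
have hs : h s <= (h (dotv u u) + h (dotv v v)) / 2.
  have -> : s = 2^-1 * dotv u u + (1 - 2^-1) * dotv v v by rewrite /s; lra.
  have /hconv/le_trans -> // : 0 <= (2^-1 : R) <= 1 by apply/andP; split; lra.
  by lra.
apply: lt_le_trans hs.
have l01 : 0 <= m / s <= 1.
  by rewrite divr_ge0 ?(ltW s0)//= ler_pdivrMr// mul1r ltW.
have := hconv _ s 0 l01; rewrite mulr0 addr0 divfK ?gt_eqF// => /le_lt_trans; apply.
have : 0 < (1 - m / s) * (h s - h 0).
  by rewrite mulr_gt0 ?subr_gt0 ?h0// ltr_pdivrMr// mul1r.
lra.
Qed.

(** * Compact boxes, and the compact set of 1-jets *)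

Lemma rV_box_compact (R : realType) (n : nat) (M : R) :
  compact [set v : 'rV[R]_n | forall i, `|v 0 i| <= M].
Proof.
have -> : [set v : 'rV[R]_n | forall i, `|v 0 i| <= M] =
          [set v : 'rV[R]_n | forall i, `[- M, M]%classic (v ord0 i)].
  by apply/seteqP; split=> v /= vM i; have := vM i; rewrite in_itv/= ler_norml.
exact: (@rV_compact R n (fun=> `[- M, M]%classic) (fun=> @segment_compact R _ _)).
Qed.

(** Continuity of [f] comes from (a): used in both orders, it squeezes [f y] between
    [f x + dotv (G x) (y - x)] and [f x + dotv (G y) (y - x)]. *)
Lemma continuous_1jet (R : realType) (n : nat) (C : set 'rV[R]_n)
    (f : 'rV[R]_n -> R) (G : 'rV[R]_n -> 'rV[R]_n) :
  {within C, continuous G} ->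
  (forall x y, C x -> C y -> f x - f y >= dotv (G y) (x - y)) ->
  {within C, continuous (fun x => (x, f x, G x))}.
Proof.
move=> /subspace_continuousP cG fG; apply/subspace_continuousP => x Cx.
have cid : y @[y --> within C (nbhs x)] --> x by apply: cvg_within.
have cf : f y @[y --> within C (nbhs x)] --> f x.
  apply: (@squeeze_cvgr _ _ _ _ (fun y => f x + dotv (G x) (y - x))
    (fun y => f x + dotv (G y) (y - x)) f).
  - near=> y; have Cy : C y by near: y; exact: withinT.
    have := fG _ _ Cy Cx; have := fG _ _ Cx Cy.
    by rewrite !dotvE => ? ?; apply/andP; split; lra.
  - rewrite -[X in _ --> X]addr0 -(_ : dotv (G x) (x - x) = 0); last first.
      by rewrite dotvBr subrr.
    exact: (cvgD (cvg_cst _) (cvg_dotv (cvg_cst _) (cvgB cid (cvg_cst _)))).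
  - rewrite -[X in _ --> X]addr0 -(_ : dotv (G x) (x - x) = 0); last first.
      by rewrite dotvBr subrr.
    exact: (cvgD (cvg_cst _) (cvg_dotv (cG _ Cx) (cvgB cid (cvg_cst _)))).
exact: (cvg_pair (cvg_pair cid cf) (cG _ Cx)).
Unshelve. all: by end_near. Qed.

Lemma cvg_pair_fst (T : Type) (U V : topologicalType) (F : set_system T)
    {FF : Filter F} (f : T -> U * V) (l : U * V) :
  f @ F --> l -> (f q).1 @[q --> F] --> l.1.
Proof. by move=> cf; apply: (continuous_cvg _ _ cf); exact: cvg_fst. Qed.

Lemma cvg_pair_snd (T : Type) (U V : topologicalType) (F : set_system T)
    {FF : Filter F} (f : T -> U * V) (l : U * V) :
  f @ F --> l -> (f q).2 @[q --> F] --> l.2.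
Proof. by move=> cf; apply: (continuous_cvg _ _ cf); exact: cvg_snd. Qed.

(* [J] stands for the set of triples (x, f x, G x) with x in C: on it f and G
   become projections, which are continuous on the whole space. *)
Lemma jet_modulus (R : realType) (n : nat) (J : set ('rV[R]_n * R * 'rV[R]_n)) :
  J !=set0 -> compact J ->
  (forall a b, J a -> J b -> dotv b.2 (a.1.1 - b.1.1) <= a.1.2 - b.1.2) ->
  (forall a b, J a -> J b -> a.1.2 - b.1.2 = dotv b.2 (a.1.1 - b.1.1) ->
    a.2 = b.2) ->
  exists h : R -> R,
    [/\ forall a b, J a -> J b ->
          h (dotv (a.2 - b.2) (a.2 - b.2)) <=
          a.1.2 - b.1.2 - dotv b.2 (a.1.1 - b.1.1),
        h 0 = 0,
        forall t, 0 < t -> 0 < h t,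
        forall s t, s <= t -> 0 <= h t - h s <= t - s
      & forall l s t, 0 <= l <= 1 ->
          h (l * s + (1 - l) * t) <= l * h s + (1 - l) * h t].
Proof.
move=> J0 cJ Jle Jeq.
pose E := ('rV[R]_n * R * 'rV[R]_n)%type.
pose D (p : E * E) : R :=
  p.1.1.2 - p.2.1.2 - dotv p.2.2 (p.1.1.1 - p.2.1.1).
pose Q (p : E * E) : R := dotv (p.1.2 - p.2.2) (p.1.2 - p.2.2).
have cfst (p : E * E) : q.1 @[q --> p] --> p.1 by exact: cvg_fst.
have csnd (p : E * E) : q.2 @[q --> p] --> p.2 by exact: cvg_snd.
have cD : continuous D.
  move=> p.
  have cx : q.1.1.1 - q.2.1.1 @[q --> p] --> p.1.1.1 - p.2.1.1.
    exact: (cvgB (cvg_pair_fst (cvg_pair_fst (cfst p)))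
      (cvg_pair_fst (cvg_pair_fst (csnd p)))).
  have cv : q.1.1.2 - q.2.1.2 @[q --> p] --> p.1.1.2 - p.2.1.2.
    exact: (cvgB (cvg_pair_snd (cvg_pair_fst (cfst p)))
      (cvg_pair_snd (cvg_pair_fst (csnd p)))).
  exact: (cvgB cv (cvg_dotv (cvg_pair_snd (csnd p)) cx)).
have cQ : continuous Q.
  move=> p.
  have c : (q.1.2 - q.2.2) @[q --> p] --> (p.1.2 - p.2.2).
    exact: (cvgB (cvg_pair_snd (cfst p)) (cvg_pair_snd (csnd p))).
  exact: (cvg_dotv c c).
have JJ0 : (J `*` J) !=set0 by case: J0 => a Ja; exists (a, a).
have cJJ := compact_setX cJ cJ.
have D0 p : (J `*` J) p -> 0 <= D p.
  by move=> [/= J1 J2]; rewrite subr_ge0; exact: Jle.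
have [||h [hD h0 hgt hlip hconv]] :=
  @convex_minorant R {p : E * E | (J `*` J) p} (D \o sval) (Q \o sval).
- by move=> [p Jp]; exact: D0.
- move=> e e0.
  have [p0 /set_mem Jp0 Qmax] := compact_EVT_max JJ0 cJJ (continuous_subspaceT cQ).
  (* By (b), [D = 0] forces [Q = 0] on pairs from [J], so [Psi] is positive there and its minimum
     bounds [D] from below wherever [Q > e]. *)
  pose Psi := D \max (fun p => e - Q p).
  have cPsi : continuous Psi.
    by move=> p; exact: (@continuous_max R _ D _ p (cD p) (cvgB (cvg_cst _) (cQ p))).
  have [p1 /set_mem Jp1 Psimin] := compact_EVT_min JJ0 cJJ (continuous_subspaceT cPsi).
  have d0 : 0 < Psi p1.
    rewrite lt_max; have [D1|D1] := ltP 0 (D p1); first by [].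
    have [J1 J2] := Jp1; have D1E : D p1 = 0.
      by apply/eqP; rewrite eq_le D1 D0.
    move/eqP: D1E; rewrite /D subr_eq0 => /eqP/(Jeq _ _ J1 J2) E12.
    by rewrite /Q E12 subrr dotv0r subr0 e0 orbT.
  have Q0 : 0 <= Q p0 := dotvv_ge0 _.
  have Q1 : 0 < Q p0 + 1 by lra.
  (* [Q p0] is the maximum of [Q], so [Q p - e <= Q p0 + 1]; the added 1 keeps the denominator
     positive. *)
  exists (Psi p1 / (Q p0 + 1)); first by rewrite divr_gt0.
  move=> [p Jp] /=.
  have [Qe|Qe] := leP (Q p) e.
    by apply: le_trans (D0 _ Jp); rewrite mulr_ge0_le0 ?subr_le0// divr_ge0 ?ltW.
  have : Psi p1 <= Psi p by apply: Psimin; rewrite inE.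
  rewrite le_max => /orP[dD|]; last first.
    by move=> /(lt_le_trans d0); rewrite subr_gt0 => /(lt_trans Qe); rewrite ltxx.
  apply: le_trans dD; rewrite mulrAC ler_pdivrMr// ler_wpM2l ?(ltW d0)//.
  by have := Qmax p; rewrite inE => /(_ Jp); lra.
exists h; split=> // a b Ja Jb.
by have := hD (exist _ (a, b) (conj Ja Jb)).
Qed.

(** * Construction of the extension, and the equivalence *)

Lemma convex_C1_extension (R : realType) (n : nat) (C : set 'rV[R]_n)
    (f : 'rV[R]_n -> R) (G : 'rV[R]_n -> 'rV[R]_n) :
  C !=set0 -> compact C -> {within C, continuous G} ->
  (forall x y, C x -> C y -> f x - f y >= dotv (G y) (x - y)) ->
  (forall x y, C x -> C y -> f x - f y = dotv (G y) (x - y) -> G x = G y) ->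
  exists F : 'rV[R]_n -> R,
    [/\ convex_function [set: 'rV[R]_n] F,
        C1_function F,
        (forall x, C x -> F x = f x)
      & (forall x, C x -> gradient F x = G x)].
Proof.
move=> C0 cC cG fle feq.
pose E := ('rV[R]_n * R * 'rV[R]_n)%type.
pose jet x : E := (x, f x, G x).
pose J := [set jet x | x in C].
have J0 : J !=set0 by case: C0 => x Cx; exists (jet x), x.
have cJ : compact J by apply: continuous_compact cC; exact: continuous_1jet.
have [||h [hD h0 hgt hlip hconv]] := jet_modulus J0 cJ.
- by move=> _ _ [x Cx <-] [y Cy <-]; exact: fle.
- by move=> _ _ [x Cx <-] [y Cy <-]; exact: feq.
have ch : continuous h.
  move=> t; apply/cvgrPdist_le => e e0; near=> s.
  have : `|t - s| <= e by near: s; exact: cvgr_dist_le.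
  rewrite !ler_norml => /andP[ts1 ts2].
  have [st|/ltW st] := leP s t; have /andP[? ?] := hlip _ _ st;
    by apply/andP; split; lra.
pose phi (ap : E * 'rV[R]_n) : R :=
  dotv ap.1.1.1 ap.2 - ap.1.1.2 + h (dotv (ap.2 - ap.1.2) (ap.2 - ap.1.2)).
have cphi : continuous phi.
  move=> ap.
  have c1 : q.1 @[q --> ap] --> ap.1 by exact: cvg_fst.
  have c2 : q.2 @[q --> ap] --> ap.2 by exact: cvg_snd.
  have cq : q.2 - q.1.2 @[q --> ap] --> ap.2 - ap.1.2.
    exact: (cvgB c2 (cvg_pair_snd c1)).
  have cv : dotv q.1.1.1 q.2 - q.1.1.2 @[q --> ap] -->
      dotv ap.1.1.1 ap.2 - ap.1.1.2.
    exact: (cvgB (cvg_dotv (cvg_pair_fst (cvg_pair_fst c1)) c2)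
      (cvg_pair_snd (cvg_pair_fst c1))).
  exact: (cvgD cv (continuous_cvg _ (ch _) (cvg_dotv cq cq))).
have [H cH HP] := continuous_compact_max J0 cJ cphi.
have Hge x p : C x -> dotv x p - f x + h (dotv (p - G x) (p - G x)) <= H p.
  by move=> Cx; apply: ((HP p).2 (jet x)); exists x.
(* With [x] attaining the maximum at the midpoint, strict midpoint convexity of [phi (jet x, _)]
   passes to [H], which dominates it at [p] and [q]. *)
have Hmid p q : p != q -> H (2^-1 *: (p + q)) < (H p + H q) / 2.
  move=> pq; have [[_ [x Cx <-] ->] _] := HP (2^-1 *: (p + q)).
  have := Hge _ p Cx; have := Hge _ q Cx.
  have := @midpoint_comp_dotv R n h _ hconv (p - G x) (q - G x).
  rewrite h0 (inj_eq (addIr _)) => /(_ hgt pq).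
  have -> : 2^-1 *: (p - G x + (q - G x)) = 2^-1 *: (p + q) - G x.
    rewrite addrACA -opprD scalerBr; congr (_ - _).
    by rewrite -mulr2n -[G x *+ 2]scaler_nat scalerA mulVf ?pnatr_eq0// scale1r.
  by rewrite /phi /= dotvZr dotvDr; lra.
have HG x : C x -> H (G x) = dotv x (G x) - f x.
  move=> Cx; apply/eqP; rewrite eq_le; apply/andP; split; last first.
    by have := Hge _ (G x) Cx; rewrite subrr dotv0r h0 addr0.
  have [[_ [y Cy <-] ->] _] := HP (G x); rewrite /phi /=.
  (* The lower bound on the excess at [(y, x)] says exactly that [y] contributes no more than [x] to
     the maximum at [G x]. *)
  have := hD (jet y) (jet x) (imageP _ Cy) (imageP _ Cx).
  have -> : dotv (G x - G y) (G x - G y) = dotv (G y - G x) (G y - G x).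
    by rewrite !dotvE; ring.
  by move: (h _) => c; rewrite /= dotvBr (dotvC (G x) y) (dotvC (G x) x); lra.
have [a /set_mem Ca amax] := compact_EVT_max J0 cJ
  (continuous_subspaceT (fun q : E => cvg_norm (cvg_pair_snd (@cvg_id _ (nbhs q))))).
pose B := [set v : 'rV[R]_n | forall i, `|v 0 i| <= `|a.2|].
have BG x : C x -> B (G x).
  move=> Cx i; apply: le_trans (coord_ler_norm _ _) _.
  by apply: (amax (jet x)); rewrite inE; exists x.
have B0 : B !=set0 by case: C0 => x Cx; exists (G x); exact: BG.
have Bmid p q : B p -> B q -> B (2^-1 *: (p + q)).
  move=> Bp Bq i; rewrite !mxE normrM ger0_norm ?invr_ge0//.
  by have := ler_normD (p 0 i) (q 0 i); have := Bp i; have := Bq i; lra.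
have [g cg gP] := strictly_convex_argmax B0 (@rV_box_compact R n _) Bmid cH Hmid.
pose F z := dotv z (g z) - H (g z).
(* [g z] competes in the maximum defining [F w], so [g z] is a subgradient of [F] at [z]. *)
have FP z w : dotv (g z) (w - z) <= F w - F z.
  have [Bgz _] := gP z; have [_ gwmax] := gP w.
  have : dotv w (g z) - H (g z) <= F w.
    by have [->//|gzw] := eqVneq (g z) (g w); exact/ltW/gwmax.
  by rewrite /F dotvBr !(dotvC (g z)); lra.
(* The objective equals [f x] at [G x], but by [Hge] is at most [f x - h (...)] at [g x]; the [h]
   term is positive if [g x] differs from [G x]. *)
have gG x : C x -> g x = G x.
  move=> Cx; apply/esym/eqP/negP => /negP Gg; have [_ gmax] := gP x.
  have := gmax _ (BG _ Cx) Gg; rewrite HG//.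
  have := Hge _ (g x) Cx.
  have : 0 < h (dotv (g x - G x) (g x - G x)).
    by apply: hgt; rewrite lt_def dotvv_ge0 dotvv_eq0 subr_eq0 eq_sym Gg.
  by lra.
have FD := subgradient_diff FP cg.
have gradF : gradient F = g by apply/funext => z; exact: (FD z).2.
exists F; split.
- exact: subgradient_convex FP.
- by split=> [x|]; [exact: (FD x).1|rewrite gradF].
- by move=> x Cx; rewrite /F gG// HG//; lra.
- by move=> x Cx; rewrite gradF gG.
Unshelve. all: by end_near. Qed.

(* f and G are functions on C: only their values on C matter, and the
   continuity of G is that of its restriction to C. *)
Theorem theorem1p10 (R : realType) (n : nat) (C : set 'rV[R]_n)
    (f : 'rV[R]_n -> R) (G : 'rV[R]_n -> 'rV[R]_n) :
  compact C ->
  {within C, continuous G} ->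
  (exists F : 'rV[R]_n -> R,
     [/\ convex_function [set: 'rV[R]_n] F,
         C1_function F,
         (forall x, C x -> F x = f x)
       & (forall x, C x -> gradient F x = G x)])
  <->
  ((forall x y, C x -> C y -> f x - f y >= dotv (G y) (x - y)) /\
   (forall x y, C x -> C y -> f x - f y = dotv (G y) (x - y) -> G x = G y)).
Proof.
move=> cC cG; split=> [[F [cF [dF _] Ff FG]]|[fle feq]].
  split=> x y Cx Cy; rewrite -!Ff// -!FG//.
    exact: convex_gradient_le.
  exact: convex_gradient_eq.
have [C0|/set0P/negP/negPn/eqP C0] := pselect (C !=set0).
  exact: convex_C1_extension.
(* For empty [C] any convex C1 function will do; zero data on the single point 0 provide one. *)
have [||||| F [cF C1F _ _]] :=
  @convex_C1_extension R n [set 0] (fun=> 0) (fun=> 0).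
- by exists 0.
- exact: compact_set1.
- exact: (continuous_subspaceT (@cst_continuous _ _ _)).
- by move=> x y -> ->; rewrite !subrr dotv0r.
- by [].
by exists F; split=> // x; rewrite C0.
Qed.
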